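(* Let $M$ be a reduced $\mathscr{A}(1)$-module which is bounded below and such that $H^{<0}(M,Q_j)=0$ for $j\in\{0,1\}$ (so that $M=M^{\geq -3}$). (1) If $M^{-3}\neq 0$, then there is a canonical inclusion $[M^{-3}]\otimes \Sigma^3\Omega^{-1}\mathbb{F}\hookrightarrow M$, the image $Sq^1Sq^2(M^{-3})$ lies in $\ker(Q_1)$, and the composite $M^{-3}\xrightarrow{Sq^1Sq^2} M^0\to H^0(M,Q_1)$ is a monomorphism (in particular it is non-trivial). (2) If $M^{-3}=0$ and $M^{-2}\neq 0$, set $V^{-2}:=\ker(Sq^1Sq^2: M^{-2}\to M^1)$ and $W^1:=\mathrm{image}(Sq^1Sq^2:M^{-2}\to M^1)$. Then there is a canonical inclusion $[V^{-2}]\otimes J\to M$, the image $Sq^2(V^{-2})$ lies in $\ker(Q_1)$, and the composite $V^{-2}\xrightarrow{Sq^2}M^0\to H^0(M,Q_1)$ is a monomorphism. Similarly, there is an injection $W^1\hookrightarrow H^1(M,Q_1)$; in particular, if $H^1(M,Q_1)=0$ then $V^{-2}=M^{-2}$. (3) If $M^{-3}=0=M^{-2}$ and $M^{-1}\neq 0$, set $X:=\ker(Sq^2: M^{-1}\to M^{1})$ and $Y:=\ker(Sq^2Sq^2:M^{-1}\to M^3)$, so that $X\subset Y\subset M^{-1}$. Then: (a) $Q_0Y$ lies in $\ker(Q_1)$ and yields a subspace $Q_0Y\subset H^0(M,Q_1)$; (b) $Q_1$ acts injectively on $X$, by $Sq^2Sq^1$, hence induces a monomorphism $[X]\otimes\Sigma^3\Omega^{-1}J\hookrightarrow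 M$; (c) if $X=0$ and $H^1(M,Q_1)=0$, then $Sq^2Sq^1Sq^2:M^{-1}\to M^4$ is injective. If, in addition, $H^2(M,Q_1)=0$, then $Y=M^{-1}$ and there is a monomorphism $[M^{-1}]\otimes\Sigma^6\Omega^{-2}J\hookrightarrow M$. This restricts to an inclusion $[M^{-1}]\otimes\mathbb{F}\hookrightarrow M$.
   Context: $\mathbb{F}=\mathbb{F}_2$; $\mathscr{A}(1)$ is the sub-Hopf algebra of the mod 2 Steenrod algebra generated by $Sq^1,Sq^2$; $Q_0=Sq^1$, $Q_1=Sq^1Sq^2+Sq^2Sq^1$. Modules are $\mathbb{Z}$-graded, operations raise degree, $\otimes$ is over $\mathbb{F}$ with the diagonal action, $(\Sigma M)^n=M^{n-1}$. $H^*(M,Q_j)=\ker Q_j/\mathrm{im}\,Q_j$ is Margolis cohomology. $M$ is bounded below if $M^n=0$ for $n\ll0$; $M^{\geq d}$ is the part of degrees $\geq d$. An $\mathscr{A}(1)$-module is reduced if $Sq^2Sq^2Sq^2$ acts trivially; a bounded-below (or finite) module decomposes as free $\oplus\, M^{\mathrm{red}}$ with $M^{\mathrm{red}}$ reduced. For a degree component $M^n$ (or a subspace), $[M^n]$ denotes this vector space placed in degree $0$. $\Omega\mathbb{F}$ is the augmentation ideal of $\mathscr{A}(1)$, $\Omega^{-1}\mathbb{F}$ its $\mathbb{F}$-linear dual (so $\Omega^{-1}\mathbb{F}$ is $\Sigma^{-6}\mathscr{A}(1)$ modulo its socle); for $n<0$, $\Omega^nM=((\Omega^{-1}\mathbb{F})^{\otimes|n|}\otimes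 M)^{\mathrm{red}}$. $J$ (the Joker) is $\Sigma^{-2}\big(\mathscr{A}(1)/\mathscr{A}(1)Sq^1Sq^2\big)$, one-dimensional in each degree $-2,\dots,2$. Explicitly, $\Omega^{-1}J$ has a basis in degrees $-4,-3,-1$ with $Sq^1$ from degree $-4$ to $-3$ and $Sq^2$ from degree $-3$ to $-1$ non-zero; $\Omega^{-2}J$ has a basis in degrees $-7,-6,-5,-4,-2$, with non-zero operations $Sq^1:-7\to-6$, $Sq^2:-7\to-5$, $Sq^1:-5\to-4$, $Sq^2:-4\to-2$. *)

(* Defs.v *)
From HB Require Import structures.
From mathcomp Require Import all_boot all_order all_algebra.
From mathcomp Require Import boolp.

Set Implicit Arguments.
Unset Strict Implicit.
Unset Printing Implicit Defensive.

Import Order.TTheory GRing.Theory Num.Theory.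
Local Open Scope ring_scope.
Local Obligation Tactic := idtac.

Section Subspaces.
Variables (V W : lmodType 'F_2).

Definition ker_pred (f : {linear V -> W}) : {pred V} := [pred x | f x == 0].
Lemma ker_closed f : submod_closed (ker_pred f).
Proof.
split=> [|a x y]; rewrite !inE ?raddf0 // => /eqP fx /eqP fy.
by rewrite linearP fx fy scaler0 addr0.
Qed.
HB.instance Definition _ f :=
  GRing.isSubmodClosed.Build 'F_2 V (ker_pred f) (ker_closed f).
Definition ker f : submodClosed V := ker_pred f.

Definition cap_pred (A B : submodClosed V) : {pred V} :=
  [pred x | (x \in A) && (x \in B)].
Lemma cap_closed A B : submod_closed (cap_pred A B).
Proof.
split=> [|a x y]; rewrite !inE ?rpred0 // => /andP[xA xB] /andP[yA yB].
by rewrite !rpredD ?rpredZ.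
Qed.
HB.instance Definition _ A B :=
  GRing.isSubmodClosed.Build 'F_2 V (cap_pred A B) (cap_closed A B).
Definition cap A B : submodClosed V := cap_pred A B.

Definition im_pred (f : {linear V -> W}) (A : submodClosed V) : {pred W} :=
  [pred y | `[< exists2 x, x \in A & y = f x >]].
Lemma im_closed f A : submod_closed (im_pred f A).
Proof.
split=> [|a x y]; rewrite !inE; first by apply/asboolP; exists 0; rewrite ?rpred0 ?raddf0.
move=> /asboolP[x' x'A ->] /asboolP[y' y'A ->]; apply/asboolP.
by exists (a *: x' + y'); rewrite ?linearP // rpredD ?rpredZ.
Qed.
HB.instance Definition _ f A :=
  GRing.isSubmodClosed.Build 'F_2 W (im_pred f A) (im_closed f A).
Definition im f A : submodClosed W := im_pred f A.

Definition is_zero (A : submodClosed V) : Prop := forall x, x \in A -> x = 0.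

Record subspace (A : submodClosed V) :=
  Subspace { subspace_val : V; _ : subspace_val \in A }.

End Subspaces.

HB.instance Definition _ (V : lmodType 'F_2) (A : submodClosed V) :=
  [isSub for @subspace_val V A].
HB.instance Definition _ (V : lmodType 'F_2) (A : submodClosed V) :=
  [Choice of subspace A by <:].
HB.instance Definition _ (V : lmodType 'F_2) (A : submodClosed V) :=
  [SubChoice_isSubLmodule of subspace A by <:].

Definition full_pred (V : lmodType 'F_2) : {pred V} := predT.
Lemma full_closed V : submod_closed (@full_pred V).
Proof. by []. Qed.
HB.instance Definition _ V :=
  GRing.isSubmodClosed.Build 'F_2 V (@full_pred V) (full_closed V).
Definition full (V : lmodType 'F_2) : submodClosed V := @full_pred V.

(* A(1) is presented by the generators Sq1, Sq2 and the two Adem relations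
   [Sq1_Sq1] and [Sq2_Sq2], so a (left) A(1)-module is a vector space with two
   operators subject to them.  The grading is internal: [proj n] is the
   projection of the direct sum of the M^k onto its summand M^n. *)
Record A1module := {
  carrier :> lmodType 'F_2;
  Sq1 : {linear carrier -> carrier};
  Sq2 : {linear carrier -> carrier};
  proj : int -> {linear carrier -> carrier};
  proj_proj : forall m n x, proj m (proj n x) = if m == n then proj n x else 0;
  proj_sum : forall x, exists s : seq int, uniq s /\ x = \sum_(n <- s) proj n x;
  proj_Sq1 : forall n x, proj (n + 1) (Sq1 x) = Sq1 (proj n x);
  proj_Sq2 : forall n x, proj (n + 2) (Sq2 x) = Sq2 (proj n x);
  Sq1_Sq1 : forall x, Sq1 (Sq1 x) = 0;
  Sq2_Sq2 : forall x, Sq2 (Sq2 x) = Sq1 (Sq2 (Sq1 x))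
}.
Arguments Sq1 {_}.
Arguments Sq2 {_}.
Arguments proj _ _ : clear implicits.

Section Modules.
Variable M : A1module.

Definition part_pred (n : int) : {pred M} := [pred x | proj M n x == x].
Lemma part_closed n : submod_closed (part_pred n).
Proof.
split=> [|a x y]; rewrite !inE ?raddf0 // => /eqP px /eqP py.
by rewrite linearP px py.
Qed.
HB.instance Definition _ n :=
  GRing.isSubmodClosed.Build 'F_2 M (part_pred n) (part_closed n).
Definition part n : submodClosed M := part_pred n.

Definition bounded_below :=
  exists d : int, forall n, n < d -> is_zero (part n).

Definition reduced := forall x : M, Sq2 (Sq2 (Sq2 x)) = 0.

Definition Q0 : {linear M -> M} := Sq1.
Definition Q1 : {linear M -> M} := (Sq1 \o Sq2) \+ (Sq2 \o Sq1).

(* The degree n part of ker Q / im Q, for a homogeneous operator Q with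
   Q \o Q = 0.  Only the additive structure of the quotient is recorded: over
   F_2 it determines the scalar multiplication. *)
Definition cocycles (Q : {linear M -> M}) n : submodClosed M :=
  cap (part n) (ker Q).
Definition coboundaries (Q : {linear M -> M}) n : {pred subspace (cocycles Q n)} :=
  [pred z | val z \in im Q (full M)].
Arguments coboundaries : clear implicits.
Lemma coboundaries_closed Q n : zmod_closed (coboundaries Q n).
Proof.
have cobE z : (z \in coboundaries Q n) = (val z \in im Q (full M)) by [].
by split=> [|x y]; rewrite !cobE ?rpred0 // => xB yB; rewrite raddfB rpredB.
Qed.
HB.instance Definition _ Q n :=
  GRing.isZmodClosed.Build (subspace (cocycles Q n)) (coboundaries Q n)
    (coboundaries_closed Q n).
Definition Hmargolis Q n : zmodType := Quotient.quot (coboundaries Q n).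
Definition Hclass Q n (z : subspace (cocycles Q n)) : Hmargolis Q n :=
  (\pi_(Hmargolis Q n) z)%qT.

Definition Hzero Q n : Prop := forall h : Hmargolis Q n, h = 0.

(* op restricts to a linear map A -> ker Q in degree n, whose composite with
   the projection onto H^n(M, Q) is a monomorphism *)
Definition mono_to_H (A : submodClosed M) (op : M -> M) Q n : Prop :=
  exists f : {linear subspace A -> subspace (cocycles Q n)},
    (forall v, val (f v) = op (val v)) /\ injective (fun v => Hclass (f v)).

End Modules.

Definition is_morphism (M N : A1module) (f : {linear M -> N}) : Prop :=
  [/\ forall x, f (Sq1 x) = Sq1 (f x),
      forall x, f (Sq2 x) = Sq2 (f x)
    & forall n x, f (proj M n x) = proj N n (f x)].

Definition is_mono (M N : A1module) (f : {linear M -> N}) : Prop :=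
  is_morphism f /\ injective f.

(* [fsq1 b c] is the coefficient of the basis element c in Sq1 b. *)
Record fmodule := {
  basis :> finType;
  fdeg : basis -> int;
  fsq1 : basis -> basis -> 'F_2;
  fsq2 : basis -> basis -> 'F_2;
  fsq1_deg : forall b c, fsq1 b c != 0 -> fdeg c = fdeg b + 1;
  fsq2_deg : forall b c, fsq2 b c != 0 -> fdeg c = fdeg b + 2;
  fsq1_fsq1 : forall b d, \sum_c fsq1 b c * fsq1 c d = 0;
  fsq2_fsq2 : forall b d, \sum_c fsq2 b c * fsq2 c d =
    \sum_c \sum_c' fsq1 b c * fsq2 c c' * fsq1 c' d
}.
Arguments fdeg : clear implicits.

Program Definition shift (k : int) (N : fmodule) : fmodule :=
  {| basis := basis N; fdeg := fun b => fdeg N b + k;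
     fsq1 := @fsq1 N; fsq2 := @fsq2 N |}.
Next Obligation. by move=> k N b c /fsq1_deg ->; rewrite addrAC. Qed.
Next Obligation. by move=> k N b c /fsq2_deg ->; rewrite addrAC. Qed.
Next Obligation. by move=> k N b d; exact: (@fsq1_fsq1 N b d). Qed.
Next Obligation. by move=> k N b d; exact: (@fsq2_fsq2 N b d). Qed.

(* The F_2-linear dual, on the dual basis, with (a f)(x) = f (chi(a) x); the
   antipode chi of A(1) fixes Sq1 and Sq2, so Sq1 and Sq2 act by transposes. *)
Program Definition dual (N : fmodule) : fmodule :=
  {| basis := basis N; fdeg := fun b => - fdeg N b;
     fsq1 := fun b c => fsq1 c b; fsq2 := fun b c => fsq2 c b |}.
Next Obligation. by move=> N b c /fsq1_deg ->; rewrite opprD addrNK. Qed.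
Next Obligation. by move=> N b c /fsq2_deg ->; rewrite opprD addrNK. Qed.
Next Obligation.
by move=> N b d; rewrite -[RHS](fsq1_fsq1 d b); apply: eq_bigr => c _; rewrite mulrC.
Qed.
Next Obligation.
move=> N b d; under eq_bigr do rewrite mulrC.
rewrite fsq2_fsq2 exchange_big; apply: eq_bigr => c _; apply: eq_bigr => c' _.
by rewrite mulrC [X in _ * X]mulrC mulrA.
Qed.

Lemma sum_sig (T : finType) (P : pred T) (F : T -> 'F_2) :
  (forall c, ~~ P c -> F c = 0) ->
  \sum_(c : {c | P c}) F (val c) = \sum_c F c.
Proof.
move=> F0; rewrite [RHS](bigID P) /= [X in _ + X]big1 // addr0.
rewrite (reindex_omap (val : {c | P c} -> T) insub) /=; last first.
  by move=> c Pc; rewrite insubT.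
by apply: eq_bigl => c; rewrite (valP c) valK eqxx.
Qed.

Section SubQuotient.
Variables (N : fmodule) (P : pred N).

Definition closed_basis :=
  [forall b, forall c, P b && ~~ P c ==> (fsq1 b c == 0) && (fsq2 b c == 0)].

Lemma closed_basisP (H : closed_basis) b c :
  P b -> ~~ P c -> fsq1 b c = 0 /\ fsq2 b c = 0.
Proof.
move=> Pb Pc; move/forallP/(_ b)/forallP/(_ c): H.
by rewrite Pb Pc => /andP[/eqP -> /eqP ->].
Qed.

Program Definition submodule (H : closed_basis) : fmodule :=
  {| basis := {b : N | P b}; fdeg := fun b => fdeg N (val b);
     fsq1 := fun b c => fsq1 (val b) (val c);
     fsq2 := fun b c => fsq2 (val b) (val c) |}.
Next Obligation. by move=> H b c /fsq1_deg. Qed.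
Next Obligation. by move=> H b c /fsq2_deg. Qed.
Next Obligation.
move=> H b d; rewrite (sum_sig (F := fun c => fsq1 (val b) c * fsq1 c (val d))).
  exact: fsq1_fsq1.
by move=> c Pc; rewrite (closed_basisP H (valP b) Pc).1 mul0r.
Qed.
Next Obligation.
move=> H b d; rewrite (sum_sig (F := fun c => fsq2 (val b) c * fsq2 c (val d))).
  rewrite fsq2_fsq2.
  rewrite -(sum_sig (P := P)); last first.
    move=> c Pc; apply: big1 => c' _.
    by rewrite (closed_basisP H (valP b) Pc).1 !mul0r.
  apply: eq_bigr => c _; rewrite -(sum_sig (P := P)) // => c' Pc'.
  by rewrite (closed_basisP H (valP c) Pc').2 mulr0 mul0r.
by move=> c Pc; rewrite (closed_basisP H (valP b) Pc).2 mul0r.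
Qed.

Program Definition quotient (H : closed_basis) : fmodule :=
  {| basis := {b : N | ~~ P b}; fdeg := fun b => fdeg N (val b);
     fsq1 := fun b c => fsq1 (val b) (val c);
     fsq2 := fun b c => fsq2 (val b) (val c) |}.
Next Obligation. by move=> H b c /fsq1_deg. Qed.
Next Obligation. by move=> H b c /fsq2_deg. Qed.
Next Obligation.
move=> H b d; rewrite (sum_sig (F := fun c => fsq1 (val b) c * fsq1 c (val d))).
  exact: fsq1_fsq1.
by move=> c /negbNE Pc; rewrite (closed_basisP H Pc (valP d)).1 mulr0.
Qed.
Next Obligation.
move=> H b d; rewrite (sum_sig (F := fun c => fsq2 (val b) c * fsq2 c (val d))).
  rewrite fsq2_fsq2 exchange_big /=.
  rewrite -(sum_sig (P := [pred c | ~~ P c])); last first.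
    move=> c /negbNE Pc; apply: big1 => c' _.
    by rewrite (closed_basisP H Pc (valP d)).1 mulr0.
  rewrite [RHS]exchange_big; apply: eq_bigr => c _.
  rewrite -(sum_sig (P := [pred c | ~~ P c])) // => c' /negbNE Pc'.
  by rewrite (closed_basisP H Pc' (valP c)).2 mulr0 mul0r.
by move=> c /negbNE Pc; rewrite (closed_basisP H Pc (valP d)).2 mulr0.
Qed.

End SubQuotient.

(* The module with one basis element in each of the listed degrees, in which
   Sq1 (resp. Sq2) sends the i-th basis element to the sum of the j-th ones
   such that (i, j) occurs in s1 (resp. s2). *)
Section Table.
Variables (d : seq int) (s1 s2 : seq (nat * nat)).
Let n := size d.

Definition table_coef (s : seq (nat * nat)) (b c : 'I_n) : 'F_2 :=
  ((val b, val c) \in s)%:R.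

Definition table_ok : bool :=
  let I := iota 0 n in
  let m s i j := (i, j) \in s in
  [&& all (fun p => nth 0 d p.2 == nth 0 d p.1 + 1) s1,
      all (fun p => nth 0 d p.2 == nth 0 d p.1 + 2) s2,
      all (fun i => all (fun j =>
        ~~ odd (count (fun k => m s1 i k && m s1 k j) I)) I) I
    & all (fun i => all (fun j =>
        odd (count (fun k => m s2 i k && m s2 k j) I) ==
        odd (sumn [seq count (fun l => [&& m s1 i k, m s2 k l & m s1 l j]) I
                  | k <- I])) I) I].

Hypothesis ok : table_ok.

Lemma F2_nat k : (k%:R : 'F_2) = (odd k)%:R.
Proof. by apply/val_inj; rewrite /= !val_Fp_nat // modn2; case: (odd k). Qed.

Lemma table_count (p : pred nat) :
  \sum_(k < n) (p k)%:R = (count p (iota 0 n))%:R :> 'F_2.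
Proof.
rewrite -sum1_count natr_sum /=.
have -> : iota 0 n = index_iota 0 n by rewrite /index_iota subn0.
by rewrite big_mkord [RHS]big_mkcond; apply: eq_bigr => i _; case: (p i).
Qed.

Program Definition table : fmodule :=
  {| basis := 'I_n; fdeg := fun b => nth 0 d (val b);
     fsq1 := table_coef s1; fsq2 := table_coef s2 |}.
Next Obligation.
move=> b c; rewrite /table_coef; case: (boolP (_ \in _)) => [H _|_]; last by rewrite eqxx.
by case/and4P: ok => /allP /(_ _ H) /eqP.
Qed.
Next Obligation.
move=> b c; rewrite /table_coef; case: (boolP (_ \in _)) => [H _|_]; last by rewrite eqxx.
by case/and4P: ok => _ /allP /(_ _ H) /eqP.
Qed.
Next Obligation.
move=> b c; rewrite /table_coef; under eq_bigr do rewrite -natrM mulnb.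
rewrite (table_count (fun k => ((val b, k) \in s1) && ((k, val c) \in s1))).
have iI (i : 'I_n) : val i \in iota 0 n by rewrite mem_iota add0n /=.
case/and4P: ok => _ _ /allP /(_ _ (iI b)) /allP /(_ _ (iI c)) /negPf H _.
by rewrite F2_nat H.
Qed.
Next Obligation.
move=> b c; rewrite /table_coef; under eq_bigr do rewrite -natrM mulnb.
rewrite (table_count (fun k => ((val b, k) \in s2) && ((k, val c) \in s2))).
have iI (i : 'I_n) : val i \in iota 0 n by rewrite mem_iota add0n /=.
case/and4P: ok => _ _ _ /allP /(_ _ (iI b)) /allP /(_ _ (iI c)) /eqP H.
rewrite F2_nat H -F2_nat sumnE big_map natr_sum.
have -> : iota 0 n = index_iota 0 n by rewrite /index_iota subn0.
rewrite big_mkord; apply: eq_bigr => k _.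
under [RHS]eq_bigr do rewrite -!natrM !mulnb.
have -> : index_iota 0 n = iota 0 n by rewrite /index_iota subn0.
rewrite -table_count; apply: eq_bigr => l _.
by rewrite andbA.
Qed.

End Table.

Definition unit_module : fmodule := table (d := [:: 0]) (s1 := [::]) (s2 := [::]) isT.

(* The left regular module, on the basis
   1, Sq1, Sq2, Sq1Sq2, Sq2Sq1, Sq2Sq2, Sq2Sq1Sq2, Sq2Sq2Sq2. *)
Definition A1 : fmodule :=
  table (d := [:: 0; 1; 2; 3; 3; 4; 5; 6])
        (s1 := [:: (0, 1); (2, 3); (4, 5); (6, 7)]%N)
        (s2 := [:: (0, 2); (1, 4); (2, 5); (3, 6); (5, 7)]%N) isT.

Definition positive_degree (b : A1) := 0 < fdeg A1 b.
Lemma positive_degree_closed : closed_basis positive_degree.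
Proof.
apply/forallP => b; apply/forallP => c.
by case: b => [] [|[|[|[|[|[|[|[|b]]]]]]]] //= ?;
   case: c => [] [|[|[|[|[|[|[|[|c]]]]]]]] //= ?.
Qed.

Definition Omega_F : fmodule := submodule positive_degree_closed.
Definition OmegaInv_F : fmodule := dual Omega_F.

(* The left ideal A(1)Sq1Sq2 is spanned by Sq1Sq2, Sq2Sq1Sq2 and
   Sq1Sq2Sq1Sq2 = Sq2Sq2Sq2. *)
Definition in_ideal_Sq1Sq2 (b : A1) := val b \in [:: 3; 6; 7]%N.
Lemma in_ideal_Sq1Sq2_closed : closed_basis in_ideal_Sq1Sq2.
Proof.
apply/forallP => b; apply/forallP => c.
by case: b => [] [|[|[|[|[|[|[|[|b]]]]]]]] //= ?;
   case: c => [] [|[|[|[|[|[|[|[|c]]]]]]]] //= ?.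
Qed.

Definition Joker : fmodule := shift (- 2) (quotient in_ideal_Sq1Sq2_closed).

(* OmegaInv_J and OmegaInv2_J are only defined up to isomorphism as reduced
   parts of (Omega^{-1} F)^{\otimes n} \otimes J; these are explicit models. *)
Definition OmegaInv_J : fmodule :=
  table (d := [:: - 4; - 3; - 1]) (s1 := [:: (0, 1)]%N) (s2 := [:: (1, 2)]%N) isT.

Definition OmegaInv2_J : fmodule :=
  table (d := [:: - 7; - 6; - 5; - 4; - 2])
        (s1 := [:: (0, 1); (2, 3)]%N) (s2 := [:: (0, 2); (3, 4)]%N) isT.

Section Tensor.
Variables (V : lmodType 'F_2) (N : fmodule).

(* V \otimes N with V in degree 0; u stands for the sum over b of
   (u b) \otimes b. *)
Notation T := {ffun N -> V}.

Definition tens_act (s : N -> N -> 'F_2) (u : T) : T :=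
  [ffun c => \sum_b s b c *: u b].
Lemma tens_act_linear s : linear (tens_act s).
Proof.
move=> a u v; apply/ffunP => c; rewrite !ffunE scaler_sumr -big_split /=.
by apply: eq_bigr => b _; rewrite !ffunE scalerDr !scalerA mulrC.
Qed.
HB.instance Definition _ s :=
  GRing.isLinear.Build 'F_2 T T *:%R (tens_act s) (tens_act_linear s).

Definition tens_proj (n : int) (u : T) : T :=
  [ffun b => if fdeg N b == n then u b else 0].
Lemma tens_proj_linear n : linear (tens_proj n).
Proof.
move=> a u v; apply/ffunP => c; rewrite !ffunE.
by case: ifP => _; rewrite ?scaler0 ?addr0.
Qed.
HB.instance Definition _ n :=
  GRing.isLinear.Build 'F_2 T T *:%R (tens_proj n) (tens_proj_linear n).

Lemma tens_act_comp s t u :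
  tens_act t (tens_act s u) = tens_act (fun b d => \sum_c s b c * t c d) u.
Proof.
apply/ffunP => d; rewrite !ffunE; under eq_bigr do rewrite ffunE scaler_sumr.
rewrite exchange_big; apply: eq_bigr => b _; rewrite scaler_suml.
by apply: eq_bigr => c _; rewrite scalerA mulrC.
Qed.

Lemma tens_proj_act s (k : int) :
  (forall b c, s b c != 0 -> fdeg N c = fdeg N b + k) ->
  forall n u, tens_proj (n + k) (tens_act s u) = tens_act s (tens_proj n u).
Proof.
move=> sk n u; apply/ffunP => c; rewrite !ffunE.
case: ifP => [/eqP cn|/eqP cn].
  apply: eq_bigr => b _; rewrite ffunE; case: ifP => // /eqP bn.
  have [->|/sk bc] := eqVneq (s b c) 0; first by rewrite !scale0r.
  by case: bn; apply: (addIr k); rewrite -bc.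
symmetry; apply: big1 => b _; rewrite ffunE.
case: ifP => [/eqP bn|_]; last by rewrite scaler0.
have [->|/sk bc] := eqVneq (s b c) 0; first by rewrite scale0r.
by case: cn; rewrite bc bn.
Qed.

Program Definition tens : A1module :=
  {| carrier := T;
     Sq1 := tens_act (@fsq1 N); Sq2 := tens_act (@fsq2 N);
     proj := tens_proj |}.
Next Obligation.
move=> m n u; apply/ffunP => b /=.
have [->|mn] := eqVneq m n; rewrite !ffunE; first by case: (_ == n).
by have [->|//] := eqVneq (fdeg N b) m; rewrite (negPf mn).
Qed.
Next Obligation.
move=> u; exists (undup [seq fdeg N b | b : N]); split; first exact: undup_uniq.
apply/ffunP => b; rewrite sum_ffunE.
have bs : fdeg N b \in undup [seq fdeg N b | b : N].
  by rewrite mem_undup map_f // mem_enum.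
rewrite (bigD1_seq (fdeg N b) bs (undup_uniq _)) /= ffunE eqxx big1 ?addr0 //.
by move=> n nb; rewrite ffunE eq_sym (negPf nb).
Qed.
Next Obligation. by move=> n u; apply: tens_proj_act; exact: fsq1_deg. Qed.
Next Obligation. by move=> n u; apply: tens_proj_act; exact: fsq2_deg. Qed.
Next Obligation.
move=> u; rewrite /= tens_act_comp; apply/ffunP => d; rewrite !ffunE.
by apply: big1 => b _; rewrite fsq1_fsq1 scale0r.
Qed.
Next Obligation.
move=> u; rewrite /= !tens_act_comp; apply/ffunP => d; rewrite !ffunE.
apply: eq_bigr => b _; congr (_ *: _); rewrite fsq2_fsq2.
by apply: eq_bigr => c _; rewrite mulr_sumr; apply: eq_bigr => c' _; rewrite mulrA.
Qed.

Definition pure (v : V) (b : N) : tens := [ffun c => if c == b then v else 0].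

End Tensor.

(* phi : [A] \otimes N -> M sends v \otimes b to v, for b in degree d *)
Definition extends_inclusion (M : A1module) (A : submodClosed M) (N : fmodule)
    (d : int) (phi : {linear tens (subspace A) N -> M}) : Prop :=
  forall v b, fdeg N b = d -> phi (pure v b) = val v.

(* Main.v *)
(* Write a = Sq1, b = Sq2.  Q1 = ab + ba commutes with a and b, Q0 Q1 = bb and
   Q1 b = bab, and M is reduced exactly when Q1(ab x) = bbb x vanishes.  Let n < 0
   be the lowest degree of M.  Since nothing of degree below n can be a boundary,
   Q0 is injective on M^n and Q1 on the negative part of M^{<n+3}; hence bb is
   injective on M^n if n < -1.  If ab x = Q1 y with y in M^n, then applying a gives
   bb y = a(ab x) = 0, so y = 0: the only boundary in ab(M^n) is zero.  For n < -3
   the cycle ab x has negative degree, so it vanishes, then Q1(b x) = bab x = 0 and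
   b x = 0, whence x = 0.  The same computations in the lowest degrees -3, -2, -1
   give the injections into H(M, Q1), and the injectivity in each degree of the
   maps sending v (x) e to (op_e) v, where e runs through a basis of a cyclic
   module and op_e is a word in a and b that takes the generator to e.
   In the last case, ab x = Q1 y forces bab x = Q1(b x) = Q1(b y) = bab y, so x = y
   and ba x = 0. *)

From HB Require Import structures.
Require Import Defs.
From mathcomp Require Import all_boot all_order all_algebra.
From mathcomp Require Import boolp zify.

Set Implicit Arguments.
Unset Strict Implicit.
Unset Printing Implicit Defensive.

Import Order.TTheory GRing.Theory Num.Theory.
Local Open Scope ring_scope.

Lemma addrr_F2 (V : lmodType 'F_2) (x : V) : x + x = 0.
Proof.
have -> : x + x = (1 + 1 : 'F_2) *: x by rewrite scalerDl !scale1r.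
by rewrite (_ : 1 + 1 = 0) ?scale0r //; apply/val_inj.
Qed.

Lemma addr_eq0_F2 (V : lmodType 'F_2) (x y : V) : x + y = 0 -> x = y.
Proof. by move=> xy; rewrite -[LHS]addr0 -(addrr_F2 y) addrA xy add0r. Qed.

(** * Operations and Margolis cohomology *)

Section Operations.
Variable M : A1module.
Implicit Types x y : M.

Lemma partP n x : reflect (proj M n x = x) (x \in part M n).
Proof. exact: eqP. Qed.

Lemma part_neq m n x : x \in part M n -> m != n -> proj M m x = 0.
Proof. by move=> /partP <- /negPf mn; rewrite proj_proj mn. Qed.

Lemma proj_part n x : proj M n x \in part M n.
Proof. by apply/partP; rewrite proj_proj eqxx. Qed.

Lemma Sq1_part n m x : x \in part M n -> m = n + 1 -> Sq1 x \in part M m.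
Proof. by move=> /partP xn ->; apply/partP; rewrite proj_Sq1 xn. Qed.

Lemma Sq2_part n m x : x \in part M n -> m = n + 2 -> Sq2 x \in part M m.
Proof. by move=> /partP xn ->; apply/partP; rewrite proj_Sq2 xn. Qed.

Lemma Q1E x : Q1 M x = Sq1 (Sq2 x) + Sq2 (Sq1 x). Proof. by []. Qed.

Lemma proj_Q1 n x : proj M (n + 3) (Q1 M x) = Q1 M (proj M n x).
Proof.
rewrite !Q1E linearD /= (_ : n + 3 = n + 2 + 1); last lia.
by rewrite proj_Sq1 proj_Sq2 addrAC proj_Sq2 proj_Sq1.
Qed.

Lemma Q1_Sq1 x : Q1 M (Sq1 x) = Sq2 (Sq2 x).
Proof. by rewrite Q1E Sq1_Sq1 linear0 addr0 Sq2_Sq2. Qed.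

Lemma Sq1_Q1 x : Sq1 (Q1 M x) = Sq2 (Sq2 x).
Proof. by rewrite Q1E linearD /= Sq1_Sq1 add0r Sq2_Sq2. Qed.

Lemma Q1_Sq2 x : Q1 M (Sq2 x) = Sq2 (Sq1 (Sq2 x)).
Proof. by rewrite Q1E Sq2_Sq2 Sq1_Sq1 add0r. Qed.

Lemma Sq2_Q1 x : Sq2 (Q1 M x) = Sq2 (Sq1 (Sq2 x)).
Proof. by rewrite Q1E linearD /= [X in _ + X]Sq2_Sq2 Sq1_Sq1 !linear0 addr0. Qed.

Lemma Q1_Sq1Sq2 x : reduced M -> Q1 M (Sq1 (Sq2 x)) = 0.
Proof. by move=> Mred; rewrite Q1_Sq1. Qed.

Lemma Hclass_eqP (Q : {linear M -> M}) n (z t : subspace (cocycles Q n)) :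
  Hclass z = Hclass t <-> exists y, val z - val t = Q y.
Proof.
have -> : (Hclass z = Hclass t) <-> (val z - val t \in im Q (full M)).
  rewrite -raddfB -[X in _ <-> is_true X]/(z - t \in @coboundaries M Q n).
  by rewrite Quotient.idealrBE; split=> [zt|/eqP//]; apply/eqP.
split; first by move=> /asboolP[y _ ->]; exists y.
by move=> [y zty]; apply/asboolP; exists y.
Qed.

Lemma Hzero_im (Q : {linear M -> M}) n x :
  Hzero Q n -> x \in part M n -> Q x = 0 -> exists y, x = Q y.
Proof.
move=> Hn xn Qx.
have xQ : x \in cocycles Q n by rewrite inE xn /= inE Qx.
have /Hclass_eqP[y] : Hclass (Subspace xQ) = Hclass 0 by rewrite [LHS]Hn [RHS]Hn.
by rewrite raddf0 addr0; exists y.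
Qed.

(** * Homogeneous operators and their boundaries *)

Section Homogeneous.
Variables (Q : {linear M -> M}) (k : int).
Hypothesis proj_Q : forall n x, proj M (n + k) (Q x) = Q (proj M n x).

(** Projecting an arbitrary preimage to degree n - k keeps it a preimage. *)
Lemma im_part n x y :
  x \in part M n -> x = Q y -> exists2 y', y' \in part M (n - k) & x = Q y'.
Proof.
move=> /partP xn xy; exists (proj M (n - k) y); first exact: proj_part.
by rewrite -proj_Q subrK -xy xn.
Qed.

Lemma Hzero_preim n x :
  Hzero Q n -> x \in part M n -> Q x = 0 ->
  exists2 y, y \in part M (n - k) & x = Q y.
Proof. by move=> Hn xn Qx; have [y] := Hzero_im Hn xn Qx; apply: im_part. Qed.

(** The cycle x is a boundary, and its preimage can be taken in degree n - k, where M vanishes. *)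
Lemma Hzero_inj n x :
  Hzero Q n -> is_zero (part M (n - k)) -> x \in part M n -> Q x = 0 -> x = 0.
Proof.
by move=> Hn M0 xn Qx; have [y /M0-> ->] := Hzero_preim Hn xn Qx; rewrite raddf0.
Qed.

(** Criterion behind every embedding into H(M, Q1) below: if two elements have the same class, [op]
    sends their difference to a boundary, with a preimage in degree n - k. *)
Lemma mono_to_H_im (A : submodClosed M) (op : {linear M -> M}) n :
  (forall x, x \in A -> op x \in part M n) ->
  (forall x, x \in A -> Q (op x) = 0) ->
  (forall x y, x \in A -> y \in part M (n - k) -> op x = Q y -> x = 0) ->
  mono_to_H A op Q n.
Proof.
move=> opn Qop op_inj.
have opQ x : x \in A -> op x \in cocycles Q n.
  by move=> xA; rewrite inE opn //= inE Qop.
pose f (v : subspace A) : subspace (cocycles Q n) := Subspace (opQ _ (valP v)).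
have f_lin : linear f.
  by move=> a u v; apply: val_inj; rewrite /= !linearP.
pose F : {linear subspace A -> subspace (cocycles Q n)} :=
  HB.pack f (GRing.isLinear.Build _ _ _ _ f f_lin).
exists F; split=> // u v /Hclass_eqP[y].
have uvA : val u - val v \in A by rewrite -scaleN1r rpredD ?rpredZ //; exact: valP.
rewrite /= -linearB => /(im_part (opn _ uvA))[y' y'n /op_inj-/(_ uvA y'n)].
by move/subr0_eq/val_inj.
Qed.

End Homogeneous.

(** * Injectivity of the operations near the lowest degree n *)

Section Lowest.
Hypotheses (M_reduced : reduced M)
  (HQ0 : forall n : int, n < 0 -> Hzero (Q0 M) n)
  (HQ1 : forall n : int, n < 0 -> Hzero (Q1 M) n).
Variable n : int.
Hypothesis low : forall k, k < n -> is_zero (part M k).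

Lemma Sq1_inj x : n < 0 -> x \in part M n -> Sq1 x = 0 -> x = 0.
Proof. by move=> n0; apply: (Hzero_inj (@proj_Sq1 M) (HQ0 n0)); apply: low; lia. Qed.

Lemma Q1_inj k x : k < n + 3 -> k < 0 -> x \in part M k -> Q1 M x = 0 -> x = 0.
Proof. by move=> kn k0; apply: (Hzero_inj proj_Q1 (HQ1 k0)); apply: low; lia. Qed.

(** Here bb = Q1 Q0, and n < -1 keeps the degree n + 1 of a x negative, so that [Q1_inj] applies to
    it. *)
Lemma Sq2Sq2_inj x : n < -1 -> x \in part M n -> Sq2 (Sq2 x) = 0 -> x = 0.
Proof.
rewrite -Q1_Sq1 => n2 xn /Q1_inj-/(_ (n + 1)) Sq1x.
by apply: (@Sq1_inj x) => //; [lia|apply: Sq1x; [lia|lia|apply: Sq1_part xn _]].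
Qed.

Lemma Sq1Sq2_eq_Q1 x y :
  n < -1 -> y \in part M n -> Sq1 (Sq2 x) = Q1 M y -> y = 0.
Proof.
move=> n2 yn xy; apply: (Sq2Sq2_inj n2 yn).
by rewrite -Sq1_Q1 -xy Sq1_Sq1.
Qed.

(** Since bab x = Q1(b x) and n < -2 makes the degree n + 2 of b x negative, b x = 0 and then bb x =
    0. *)
Lemma Sq1Sq2_inj x : n < -2 -> x \in part M n -> Sq1 (Sq2 x) = 0 -> x = 0.
Proof.
move=> n3 xn x0; apply: Sq2Sq2_inj => //; first by lia.
rewrite (_ : Sq2 x = 0) ?linear0 //; apply: (@Q1_inj (n + 2)); [lia|lia| |].
  exact: Sq2_part xn _.
by rewrite Q1_Sq2 x0 linear0.
Qed.

End Lowest.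

Lemma part_lt_m3 : reduced M -> bounded_below M ->
  (forall n : int, n < 0 -> Hzero (Q0 M) n) ->
  (forall n : int, n < 0 -> Hzero (Q1 M) n) ->
  forall n : int, n < - 3 -> is_zero (part M n).
Proof.
move=> Mred [d dM] HQ0 HQ1 n.
(* The induction bounds the distance of n above d, so all degrees below n are already known to
   vanish. *)
have [j] : exists j : nat, n < d + j%:Z by exists (absz (n - d + 1)); lia.
elim: j n => [|j IHj] n nj n3; first by apply: dM; lia.
have low k : k < n -> is_zero (part M k) by move=> kn; apply: IHj; lia.
move=> x xn; apply: (Sq1Sq2_inj HQ0 HQ1 low) => //; first lia.
have n30 : n + 3 < 0 by lia.
have abn : Sq1 (Sq2 x) \in part M (n + 3).
  by apply: Sq1_part (Sq2_part xn erefl) _; lia.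
have [y] := Hzero_preim proj_Q1 (HQ1 _ n30) abn (Q1_Sq1Sq2 x Mred).
(* The preimage y is back in degree n, as ab and Q1 both raise degrees by 3. *)
rewrite addrK => yn xy; rewrite xy.
by rewrite (Sq1Sq2_eq_Q1 HQ0 HQ1 low _ yn xy) ?linear0 //; lia.
Qed.

End Operations.

(** * Monomorphisms out of tensor products *)

Section TensorMap.
Variables (M : A1module) (A : submodClosed M) (N : fmodule).
Variable g : N -> {linear M -> M}.
Implicit Type u : tens (subspace A) N.

(** [g b] gives the image of v (x) b as an operation applied to v, usually the word in [Sq1] and
    [Sq2] that takes the cyclic generator to b. *)
Definition tens_lift u : M := \sum_b g b (val (u b)).

Lemma tens_lift_linear : linear tens_lift.
Proof.
move=> a u v; rewrite /tens_lift scaler_sumr -big_split /=; apply: eq_bigr => b _.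
by rewrite !ffunE /= linearP.
Qed.
HB.instance Definition _ :=
  GRing.isLinear.Build 'F_2 (tens (subspace A) N) M *:%R tens_lift tens_lift_linear.

Lemma tens_lift_pure v b : tens_lift (pure v b) = g b (val v).
Proof.
rewrite /tens_lift (bigD1 b) //= ffunE eqxx big1 ?addr0 // => c /negPf cb.
by rewrite ffunE cb raddf0.
Qed.

Lemma tens_lift_act (s : N -> N -> 'F_2) (op : {linear M -> M}) :
  (forall b v, v \in A -> op (g b v) = \sum_c s b c *: g c v) ->
  forall u, tens_lift (tens_act s u) = op (tens_lift u).
Proof.
move=> gs u; rewrite /tens_lift linear_sum /=.
under [RHS]eq_bigr do rewrite (gs _ _ (valP _)).
rewrite exchange_big; apply: eq_bigr => c _; rewrite ffunE -[subspace_val _]/(val _) !raddf_sum /=.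
by apply: eq_bigr => b _; rewrite linearZ.
Qed.

Hypothesis g_Sq1 :
  forall b v, v \in A -> Sq1 (g b v) = \sum_c fsq1 b c *: g c v.
Hypothesis g_Sq2 :
  forall b v, v \in A -> Sq2 (g b v) = \sum_c fsq2 b c *: g c v.
Hypothesis g_part : forall b v, v \in A -> g b v \in part M (fdeg N b).
Hypothesis g_inj : forall u n,
  \sum_(b | fdeg N b == n) g b (val (u b)) = 0 ->
  forall b, fdeg N b = n -> val (u b) = 0.

(** The lift commutes with projections, so injectivity can be tested one degree at a time. Basis
    elements may share a degree, hence the joint form of [g_inj]. *)
Lemma tens_lift_mono : is_mono tens_lift.
Proof.
have lift_proj n u : tens_lift (tens_proj n u) = proj M n (tens_lift u).
  rewrite /tens_lift linear_sum; apply: eq_bigr => b _; rewrite ffunE.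
  have gb := g_part b (valP (u b)); case: ifPn => [/eqP <-|bn].
    exact/esym/partP.
  by rewrite !raddf0 (part_neq gb) // eq_sym.
split; first by split; [exact: tens_lift_act|exact: tens_lift_act|exact: lift_proj].
apply: raddf_inj => u u0; apply/ffunP => b; apply: val_inj; rewrite ffunE.
apply: (@g_inj u (fdeg N b)) => //.
have pu0 : tens_lift (tens_proj (fdeg N b) u) = 0 by rewrite lift_proj u0 raddf0.
rewrite -[RHS]pu0 /tens_lift [LHS]big_mkcond; apply: eq_bigr => c _; rewrite ffunE.
by case: ifP => //; rewrite !raddf0.
Qed.

Lemma exists_tens_mono :
  exists phi : {linear tens (subspace A) N -> M},
    is_mono phi /\ forall v b, phi (pure v b) = g b (val v).
Proof. by exists tens_lift; split; [exact: tens_lift_mono|exact: tens_lift_pure]. Qed.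

End TensorMap.

(** * Modules with a computable labelled basis *)

Section IndexedModule.
Variables (N : fmodule) (idx : N -> nat) (l : seq nat) (d : nat -> int).
Variables s1 s2 : seq (nat * nat).

(* The basis of N is labelled injectively by the entries of l, on which degrees
   and operations are computable; this reduces sums over N to sums over l. *)
Record indexed : Prop := Indexed {
  idx_sum : forall (V : nmodType) (F : nat -> V),
    \sum_c F (idx c) = \sum_(j <- l) F j;
  idx_mem : forall c, idx c \in l;
  idx_inj : injective idx;
  fdeg_idx : forall c, fdeg N c = d (idx c);
  fsq1_idx : forall b c, fsq1 b c = ((idx b, idx c) \in s1)%:R;
  fsq2_idx : forall b c, fsq2 b c = ((idx b, idx c) \in s2)%:R
}.

End IndexedModule.

Definition A1deg (i : nat) : int := nth 0 [:: 0; 1; 2; 3; 3; 4; 5; 6] i.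

Lemma sum_A1_sub (P : pred nat) (V : nmodType) (F : nat -> V) :
  \sum_(c : {c : A1 | P (val c)}) F (val (val c)) =
  \sum_(j <- [seq j <- iota 0 8 | P j]) F j.
Proof.
rewrite big_filter -/(index_iota 0 8) big_mkord.
rewrite [RHS](reindex_omap (val : {c : A1 | P (val c)} -> A1) insub) /=.
  by apply: eq_bigl => c; rewrite (valP c) valK eqxx.
by move=> c Pc; rewrite insubT.
Qed.

(** Label i is the dual of the i-th basis element of [A1]; label 0 is lost with the unit. Dualising
    negates degrees and reverses arrows, so the generator is label 7, in degree 3 - 6 = -3. *)
Lemma OmegaInv_F_indexed :
  @indexed (shift 3 OmegaInv_F) (fun b => val (val b)) [:: 1; 2; 3; 4; 5; 6; 7]%N
    (fun i => 3 - A1deg i)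
    [seq (p.2, p.1) | p <- [:: (0, 1); (2, 3); (4, 5); (6, 7)]%N]
    [seq (p.2, p.1) | p <- [:: (0, 2); (1, 4); (2, 5); (3, 6); (5, 7)]%N].
Proof.
have swap_inj : injective (fun p : nat * nat => (p.2, p.1)).
  by move=> [? ?] [? ?] [-> ->].
split.
- move=> V F; exact: (@sum_A1_sub (fun j => 0 < A1deg j)).
- by move=> [[[|[|[|[|[|[|[|[|b]]]]]]]] //= ?] ?].
- by move=> b c /val_inj/val_inj.
- by move=> c; rewrite addrC.
- by move=> b c; rewrite /= -(mem_map swap_inj).
- by move=> b c; rewrite /= -(mem_map swap_inj).
Qed.

(** The tables of [A1] can stay whole: pairs involving the labels 3, 6, 7 of the ideal are never
    met, since only labels of the list occur. *)
Lemma Joker_indexed :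
  @indexed Joker (fun b => val (val b)) [:: 0; 1; 2; 4; 5]%N
    (fun i => A1deg i - 2)
    [:: (0, 1); (2, 3); (4, 5); (6, 7)]%N
    [:: (0, 2); (1, 4); (2, 5); (3, 6); (5, 7)]%N.
Proof.
split=> //.
- move=> V F; exact: (@sum_A1_sub (fun j => j \notin [:: 3; 6; 7]%N)).
- by move=> [[[|[|[|[|[|[|[|[|b]]]]]]]] //= ?] ?].
- by move=> b c /val_inj/val_inj.
Qed.

Lemma table_indexed d s1 s2 (ok : table_ok d s1 s2) :
  @indexed (table ok) (fun b => val b) (iota 0 (size d)) (nth 0 d) s1 s2.
Proof.
split=> //; last exact: val_inj.
- by move=> V F; rewrite -(big_mkord xpredT F) /index_iota subn0.
- by move=> b; rewrite mem_iota /=.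
Qed.

Lemma shift_indexed k N idx l d s1 s2 :
  @indexed N idx l d s1 s2 ->
  @indexed (shift k N) idx l (fun i => d i + k) s1 s2.
Proof. by case=> sumE mem_l idx_inj dE E1 E2; split=> // c; rewrite /= dE. Qed.

Section IndexedTensor.
Variables (N : fmodule) (idx : N -> nat) (l : seq nat) (d : nat -> int).
Variables s1 s2 : seq (nat * nat).
Hypothesis N_idx : indexed idx l d s1 s2.
Variables (M : A1module) (A : submodClosed M) (ops : nat -> {linear M -> M}).
Hypothesis ops_Sq1 : forall i v, i \in l -> v \in A ->
  Sq1 (ops i v) = \sum_(j <- l | (i, j) \in s1) ops j v.
Hypothesis ops_Sq2 : forall i v, i \in l -> v \in A ->
  Sq2 (ops i v) = \sum_(j <- l | (i, j) \in s2) ops j v.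
Hypothesis ops_part : forall i v, i \in l -> v \in A -> ops i v \in part M (d i).

Lemma indexed_tens_mono :
  (forall (u : nat -> M) i, (forall j, u j \in A) -> i \in l ->
     \sum_(j <- l | d j == d i) ops j (u j) = 0 -> u i = 0) ->
  exists phi : {linear tens (subspace A) N -> M},
    is_mono phi /\ forall v b, phi (pure v b) = ops (idx b) (val v).
Proof.
move=> ops_inj; have [sumE mem_l inj_idx dE E1 E2] := N_idx.
apply: (@exists_tens_mono M A N (fun b => ops (idx b))).
- move=> b v vA; rewrite ops_Sq1 // big_mkcond -sumE; apply: eq_bigr => c _.
  by rewrite E1; case: ifP; rewrite ?scale1r ?scale0r.
- move=> b v vA; rewrite ops_Sq2 // big_mkcond -sumE; apply: eq_bigr => c _.
  by rewrite E2; case: ifP; rewrite ?scale1r ?scale0r.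
- by move=> b v vA; rewrite dE; apply: ops_part.
move=> u n u0 b bn.
(* [u' j] is the value of u at the basis element labelled j, and 0 if there is none. *)
pose u' j : M := \sum_(c | idx c == j) val (u c).
have u'E c : u' (idx c) = val (u c).
  by rewrite /u' (big_pred1 c) // => c'; apply/eqP/eqP => [/inj_idx|->].
rewrite -u'E; apply: ops_inj => //.
  by move=> j; apply: rpred_sum => c _; apply: valP.
rewrite big_mkcond -sumE -big_mkcond -[RHS]u0.
by apply: eq_big => [c|c _]; rewrite ?u'E // -!dE bn.
Qed.

(** With at most one basis element per degree, joint injectivity reduces to injectivity of each
    operation. *)
Lemma indexed_tens_mono_inj :
  {in l &, injective d} -> uniq l ->
  (forall i v, i \in l -> v \in A -> ops i v = 0 -> v = 0) ->
  exists phi : {linear tens (subspace A) N -> M},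
    is_mono phi /\ forall v b, phi (pure v b) = ops (idx b) (val v).
Proof.
move=> d_inj l_uniq ops_inj; apply: indexed_tens_mono => u i uA il.
rewrite big_mkcond (bigD1_seq i) //= eqxx big_seq_cond big1 => [|j /andP[jl ji]].
  by rewrite addr0; apply: ops_inj.
by case: eqP => // /d_inj ij; rewrite ij ?eqxx in ji.
Qed.

End IndexedTensor.

Lemma extends_inclusion_idx N idx l d s1 s2 (N_idx : @indexed N idx l d s1 s2)
    (M : A1module) (A : submodClosed M) (ops : nat -> {linear M -> M}) k
    (phi : {linear tens (subspace A) N -> M}) :
  {in l, forall i, d i = k -> ops i =1 id} ->
  (forall v b, phi (pure v b) = ops (idx b) (val v)) ->
  extends_inclusion k phi.
Proof.
case: N_idx => _ mem_l _ dE _ _ ops_id phiE v b; rewrite dE phiE.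
by move/ops_id->.
Qed.

Lemma Sq1_in_part (M : A1module) m (x : M) :
  x \in part M (m - 1) -> Sq1 x \in part M m.
Proof. by move=> xm; apply: Sq1_part xm _; rewrite subrK. Qed.

Lemma Sq2_in_part (M : A1module) m (x : M) :
  x \in part M (m - 2) -> Sq2 x \in part M m.
Proof. by move=> xm; apply: Sq2_part xm _; rewrite subrK. Qed.

(** * The lowest degree of M *)

Section Bottom.
Variable M : A1module.
Hypotheses (M_reduced : reduced M)
  (HQ0 : forall n : int, n < 0 -> Hzero (Q0 M) n)
  (HQ1 : forall n : int, n < 0 -> Hzero (Q1 M) n).

Lemma Sq1_Sq2_Sq2 (x : M) : Sq1 (Sq2 (Sq2 x)) = 0.
Proof. by rewrite Sq2_Sq2 Sq1_Sq1. Qed.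

Lemma Sq2_Sq2_Sq1 (x : M) : Sq2 (Sq2 (Sq1 x)) = 0.
Proof. by rewrite Sq2_Sq2 Sq1_Sq1 !linear0. Qed.

(** Rewriting rules for words in a and b: aba becomes bb, while aa, abb, bba and bbb vanish. *)
Definition A1_rel :=
  (@Sq1_Sq1 M, fun x : M => esym (Sq2_Sq2 x), Sq1_Sq2_Sq2, Sq2_Sq2_Sq1, M_reduced).

(** * Lowest degree -3: copies of the inverse syzygy of F *)

Section DegreeM3.
Hypothesis low : forall k : int, k < -3 -> is_zero (part M k).

Lemma Sq1Sq2_coboundary_m3 x y :
  x \in part M (-3) -> y \in part M (-3) -> Sq1 (Sq2 x) = Q1 M y -> x = 0.
Proof.
move=> x3 y3 xy; apply: (Sq1Sq2_inj HQ0 HQ1 low) => //.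
by rewrite xy (Sq1Sq2_eq_Q1 HQ0 HQ1 low _ y3 xy) ?linear0.
Qed.

Lemma part_m3_tens_mono :
  exists phi : {linear tens (subspace (part M (- 3))) (shift 3 OmegaInv_F) -> M},
    is_mono phi /\ extends_inclusion (- 3) phi.
Proof.
(* The words are read off by following the reversed arrows of [A1] from the generator 7. *)
pose ops (i : nat) : {linear M -> M} := match i with
  | 1 => Sq2 \o (Sq1 \o Sq2) | 2 => Sq2 \o Sq2 | 3 => Sq2 \o Sq1
  | 4 => Sq1 \o Sq2 | 5 => Sq2 | 6 => Sq1 | _ => idfun end%N.
have [||||phi [phi_mono phiE]] :=
    @indexed_tens_mono _ _ _ _ _ _ OmegaInv_F_indexed M (part M (-3)) ops.
- by move=> i v; rewrite !inE => /or4P[|||/or4P[|||]] /eqP-> _;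
     rewrite unlock /= ?A1_rel ?addr0.
- by move=> i v; rewrite !inE => /or4P[|||/or4P[|||]] /eqP-> _;
     rewrite unlock /= ?A1_rel ?addr0.
- move=> i v il v3; rewrite !inE in il; case/or4P: il => [|||/or4P[|||]] /eqP-> //=;
    do ?[apply: Sq1_in_part | apply: Sq2_in_part]; exact: v3.
- have inj1 v : v \in part M (-3) -> Sq1 v = 0 -> v = 0.
    exact: (Sq1_inj HQ0 low).
  have inj22 v : v \in part M (-3) -> Sq2 (Sq2 v) = 0 -> v = 0.
    exact: (Sq2Sq2_inj HQ0 HQ1 low).
  (* Here bab v = Q1(b v), with b v in degree -1, the last degree covered by [Q1_inj]. *)
  have inj212 v : v \in part M (-3) -> Sq2 (Sq1 (Sq2 v)) = 0 -> v = 0.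
    rewrite -Q1_Sq2 => v3 /(Q1_inj HQ1 low (k := -1)) v2.
    by apply: inj22 => //; rewrite v2 ?linear0 //; apply: Sq2_in_part.
  (* Only the labels 3 and 4 share a degree, namely 0. From ba v = ab w follows ab(v + w) = Q1 v,
     hence v = 0, and then w = 0. *)
  have inj12_21 v w : v \in part M (-3) -> w \in part M (-3) ->
      Sq2 (Sq1 v) + Sq1 (Sq2 w) = 0 -> v = 0 /\ w = 0.
    move=> v3 w3 /addr_eq0_F2 vw.
    have vwE : Sq1 (Sq2 (v + w)) = Q1 M v by rewrite Q1E vw !linearD.
    have v0 : v = 0 by apply: (Sq1Sq2_eq_Q1 HQ0 HQ1 low _ v3 vwE).
    split=> //; apply: (@Sq1Sq2_coboundary_m3 w v) => //.
    by rewrite -vwE v0 add0r.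
  move=> u i uA; rewrite !inE => /or4P[|||/or4P[|||]] /eqP->;
    rewrite unlock /= ?addr0.
  + exact: inj212.
  + exact: inj22.
  + by case/inj12_21.
  + by case/inj12_21.
  + by move=> u0; apply: inj22 => //; rewrite u0 linear0.
  + exact: inj1.
  + by [].
exists phi; split=> //; apply: (extends_inclusion_idx OmegaInv_F_indexed) phiE => i.
by rewrite !inE => /or4P[|||/or4P[|||]] /eqP->.
Qed.

Lemma Sq1Sq2_mono_to_H :
  mono_to_H (part M (- 3)) (Sq1 \o Sq2) (Q1 M) 0.
Proof.
apply: (mono_to_H_im (@proj_Q1 M) (op := Sq1 \o Sq2)) => [x x3|x _|x y].
- by apply: Sq1_in_part; apply: Sq2_in_part.
- exact: Q1_Sq1Sq2.
exact: Sq1Sq2_coboundary_m3.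
Qed.

End DegreeM3.

(** * Lowest degree -2: Jokers on V, and classes from W *)

Section DegreeM2.
Hypothesis low : forall k : int, k < -2 -> is_zero (part M k).
Let V : submodClosed M := cap (part M (- 2)) (ker (Sq1 \o Sq2)).
Let W : submodClosed M := im (Sq1 \o Sq2) (part M (- 2)).

(** On V the relation ab v = 0 is the one that defines the Joker. Each word 1, a, b, ba, bb is a
    right factor of bb = aba, which is injective in degree -2. *)
Lemma V_tens_mono :
  exists phi : {linear tens (subspace V) Joker -> M},
    is_mono phi /\ extends_inclusion (- 2) phi.
Proof.
pose ops (i : nat) : {linear M -> M} := match i with
  | 1 => Sq1 | 2 => Sq2 | 4 => Sq2 \o Sq1 | 5 => Sq2 \o Sq2 | _ => idfun end%N.
have [|||||i v|phi [phi_mono phiE]] :=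
    @indexed_tens_mono_inj _ _ _ _ _ _ Joker_indexed M V ops.
- by move=> i v; rewrite !inE => /or4P[|||/orP[]] /eqP-> /andP[_ /eqP /= v0];
     rewrite unlock /= ?A1_rel ?addr0.
- by move=> i v; rewrite !inE => /or4P[|||/orP[]] /eqP-> /andP[_ /eqP /= v0];
     rewrite unlock /= ?A1_rel ?addr0 // v0 linear0.
- move=> i v il /andP[v2 _]; rewrite !inE in il; case/or4P: il => [|||/orP[]] /eqP-> //=;
    do ?[apply: Sq1_in_part | apply: Sq2_in_part]; exact: v2.
- by move=> i j; rewrite !inE => /or4P[|||/orP[]] /eqP-> /or4P[|||/orP[]] /eqP->.
- by [].
- move=> il /andP[v2 _] v0; apply: (Sq2Sq2_inj HQ0 HQ1 low) => //; move: il v0.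
  rewrite !inE => /or4P[|||/orP[]] /eqP-> //= => [->|v0|->|v0].
  + by rewrite !linear0.
  + by rewrite Sq2_Sq2 v0 !linear0.
  + by rewrite !linear0.
  + by rewrite Sq2_Sq2 v0 !linear0.
exists phi; split=> //; apply: (extends_inclusion_idx Joker_indexed) phiE => i.
by rewrite !inE => /or4P[|||/orP[]] /eqP->.
Qed.

Lemma Q1_Sq2_V x : x \in V -> Q1 M (Sq2 x) = 0.
Proof. by move=> /andP[_ /eqP x0]; rewrite Q1_Sq2 [Sq1 _]x0 linear0. Qed.

(** If b x = Q1 y, then y lies in degree -3, where M vanishes; so b x = 0 and bb x = 0. *)
Lemma V_mono_to_H : mono_to_H V Sq2 (Q1 M) 0.
Proof.
apply: (mono_to_H_im (@proj_Q1 M)) => [x /andP[x2 _]|x|x y /andP[x2 _] y3 xy].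
- exact: Sq2_in_part.
- exact: Q1_Sq2_V.
apply: (Sq2Sq2_inj HQ0 HQ1 low) => //.
by rewrite xy (low _ y3) ?linear0.
Qed.

Lemma W_coboundary x y : x \in W -> y \in part M (-2) -> x = Q1 M y -> x = 0.
Proof.
move=> /asboolP[v v2 ->] y2 vy; rewrite vy.
by rewrite (Sq1Sq2_eq_Q1 HQ0 HQ1 low _ y2 vy) ?linear0.
Qed.

Lemma W_part x : x \in W -> x \in part M 1.
Proof. by move=> /asboolP[v v2 ->]; apply: Sq1_in_part; apply: Sq2_in_part. Qed.

Lemma Q1_W x : x \in W -> Q1 M x = 0.
Proof. by move=> /asboolP[v v2 ->]; apply: Q1_Sq1Sq2. Qed.

Lemma W_mono_to_H : mono_to_H W id (Q1 M) 1.
Proof.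
apply: (mono_to_H_im (@proj_Q1 M) (op := idfun)).
- exact: W_part.
- exact: Q1_W.
- exact: W_coboundary.
Qed.

(** For x in degree -2, ab x is a cycle in W, hence a boundary once H^1 vanishes, and the only
    boundary in W is zero. *)
Lemma V_full : Hzero (Q1 M) 1 -> V =i part M (- 2).
Proof.
move=> H1 x; apply/andP/idP => [[]//|x2]; split=> //; apply/eqP.
have xW : Sq1 (Sq2 x) \in W by apply/asboolP; exists x.
have [y y2 xy] := Hzero_preim (@proj_Q1 M) H1 (W_part xW) (Q1_W xW).
exact: W_coboundary xW y2 xy.
Qed.

End DegreeM2.

(** * Lowest degree -1: the subspaces X and Y *)

Section DegreeM1.
Hypothesis low : forall k : int, k < -1 -> is_zero (part M k).
Let X : submodClosed M := cap (part M (- 1)) (ker Sq2).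
Let Y : submodClosed M := cap (part M (- 1)) (ker (Sq2 \o Sq2)).

Let Q1_inj_m1 x : x \in part M (-1) -> Q1 M x = 0 -> x = 0.
Proof. exact: (Q1_inj HQ1 low). Qed.

Lemma Q1_Q0_Y x : x \in Y -> Q1 M (Q0 M x) = 0.
Proof. by move=> /andP[_ /eqP x0]; rewrite Q1_Sq1. Qed.

Lemma Q0_Y_mono_to_H : mono_to_H (im (Q0 M) Y) id (Q1 M) 0.
Proof.
apply: (mono_to_H_im (@proj_Q1 M) (op := idfun)) => [x|x|x y _ y3 xy].
- by move=> /asboolP[y /andP[y1 _] ->]; apply: Sq1_in_part.
- by move=> /asboolP[y yY ->]; apply: Q1_Q0_Y.
by rewrite -[x]/(idfun x) xy (low _ y3) ?linear0.
Qed.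

Lemma Q1_X x : x \in X -> Q1 M x = Sq2 (Sq1 x).
Proof. by move=> /andP[_ /eqP x0]; rewrite Q1E x0 linear0 add0r. Qed.

Lemma Q1_X_inj : {in X &, injective (Q1 M)}.
Proof.
move=> x y /andP[x1 _] /andP[y1 _] /eqP; rewrite -subr_eq0 -linearB => /eqP xy.
apply/subr0_eq/Q1_inj_m1 => //; apply/partP.
by rewrite linearB /= (partP _ _ x1) (partP _ _ y1).
Qed.

(** On X the injective Q1 acts as ba, and the words 1, a, ba are right factors of it. The next word
    vanishes: aba v = bb v = 0. *)
Lemma X_tens_mono :
  exists phi : {linear tens (subspace X) (shift 3 OmegaInv_J) -> M},
    is_mono phi /\ extends_inclusion (- 1) phi.
Proof.
have N_idx := shift_indexed 3 (table_indexed (isT : table_ok [:: - 4; - 3; - 1]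
  [:: (0, 1)]%N [:: (1, 2)]%N)).
pose ops (i : nat) : {linear M -> M} := match i with
  | 1 => Sq1 | 2 => Sq2 \o Sq1 | _ => idfun end%N.
have [|||||i v|phi [phi_mono phiE]] :=
    @indexed_tens_mono_inj _ _ _ _ _ _ N_idx M X ops.
- by move=> i v; rewrite !inE => /or3P[] /eqP-> /andP[_ /eqP /= v0];
     rewrite unlock /= ?A1_rel ?addr0 // v0 linear0.
- by move=> i v; rewrite !inE => /or3P[] /eqP-> /andP[_ /eqP /= v0];
     rewrite unlock /= ?A1_rel ?addr0.
- move=> i v il /andP[v1 _]; rewrite !inE in il; case/or3P: il => /eqP-> //=;
    do ?[apply: Sq1_in_part | apply: Sq2_in_part]; exact: v1.
- by move=> i j; rewrite !inE => /or3P[] /eqP-> /or3P[] /eqP->.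
- by [].
- move=> il vX v0; apply: Q1_inj_m1; first by case/andP: vX.
  move: il v0; rewrite Q1_X // !inE => /or3P[] /eqP-> //= ->; rewrite !linear0 //.
exists phi; split=> //; apply: (extends_inclusion_idx N_idx) phiE => i.
by rewrite !inE => /or3P[] /eqP->.
Qed.

Lemma Sq2_inj_m1 x : is_zero X -> x \in part M (-1) -> Sq2 x = 0 -> x = 0.
Proof. by move=> X0 x1 x0; apply: X0; rewrite inE x1; apply/eqP. Qed.

(** Since bab x = Q1(b x) and M vanishes in degree -2, where a Q1-preimage of b x would lie, b x =
    0; so x lies in X = 0. *)
Lemma Sq2Sq1Sq2_inj_m1 x : is_zero X -> Hzero (Q1 M) 1 ->
  x \in part M (-1) -> Sq2 (Sq1 (Sq2 x)) = 0 -> x = 0.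
Proof.
rewrite -Q1_Sq2 => X0 H1 x1 x0; apply: Sq2_inj_m1 => //.
by apply: (Hzero_inj (@proj_Q1 M) H1) => //; [apply: low|apply: Sq2_in_part].
Qed.

Lemma Sq2Sq1Sq2_inj : is_zero X -> Hzero (Q1 M) 1 ->
  {in part M (- 1) &, injective (fun x => Sq2 (Sq1 (Sq2 x)))}.
Proof.
move=> X0 H1 x y x1 y1 /eqP; rewrite -subr_eq0 -!linearB => /eqP xy.
apply/subr0_eq/Sq2Sq1Sq2_inj_m1 => //; apply/partP.
by rewrite linearB /= (partP _ _ x1) (partP _ _ y1).
Qed.

Section Injective.
Hypotheses (X0 : is_zero X) (H1 : Hzero (Q1 M) 1) (H2 : Hzero (Q1 M) 2).

Lemma Sq2Sq1_m1 x : x \in part M (-1) -> Sq2 (Sq1 x) = 0.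
Proof.
move=> x1.
have abx : Sq1 (Sq2 x) \in part M 2 by apply: Sq1_in_part; apply: Sq2_in_part.
have [y y1 xy] := Hzero_preim (@proj_Q1 M) H2 abx (Q1_Sq1Sq2 x M_reduced).
have yx : y = x.
  by apply: (Sq2Sq1Sq2_inj X0 H1) => //; rewrite -Sq2_Q1 -xy.
by apply: (addrI (Sq1 (Sq2 x))); rewrite addr0 -Q1E -{1}yx -xy.
Qed.

Lemma Y_full : Y =i part M (- 1).
Proof.
move=> x; apply/andP/idP => [[]//|x1]; split=> //; apply/eqP => /=.
by rewrite Sq2_Sq2 Sq2Sq1_m1 // linear0.
Qed.

(** The basis corresponds to 1, a, b, ab, bab, with ba = 0 and bb = 0. All but a are right factors
    of the injective bab; a is injective because H(M, Q0) vanishes in degree -1. *)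
Lemma part_m1_tens_mono :
  exists phi : {linear tens (subspace (part M (- 1))) (shift 6 OmegaInv2_J) -> M},
    [/\ is_mono phi, extends_inclusion (- 1) phi
      & exists psi : {linear tens (subspace (part M (- 1))) unit_module -> M},
          is_mono psi /\
          forall v (b : shift 6 OmegaInv2_J) (c : unit_module),
            fdeg _ b = 0 -> psi (pure v c) = phi (pure v b)].
Proof.
have ba0 := Sq2Sq1_m1.
have bb0 x : x \in part M (-1) -> Sq2 (Sq2 x) = 0.
  by move=> x1; rewrite Sq2_Sq2 ba0 ?linear0.
have J_idx := shift_indexed 6 (table_indexed (isT : table_ok [:: - 7; - 6; - 5; - 4; - 2]
  [:: (0, 1); (2, 3)]%N [:: (0, 2); (3, 4)]%N)).
have F_idx := table_indexed (isT : table_ok [:: 0] [::] [::]).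
pose ops (i : nat) : {linear M -> M} := match i with
  | 1 => Sq1 | 2 => Sq2 | 3 => Sq1 \o Sq2 | 4 => Sq2 \o (Sq1 \o Sq2)
  | _ => idfun end%N.
have [|||||i v|phi [phi_mono phiE]] :=
    @indexed_tens_mono_inj _ _ _ _ _ _ J_idx M (part M (-1)) ops.
- by move=> i v; rewrite !inE => /or4P[|||/orP[]] /eqP-> v1;
     rewrite unlock /= ?A1_rel ?addr0.
- by move=> i v; rewrite !inE => /or4P[|||/orP[]] /eqP-> v1;
     rewrite unlock /= ?A1_rel ?addr0 // ?ba0 ?bb0.
- move=> i v il v1; rewrite !inE in il; case/or4P: il => [|||/orP[]] /eqP-> //=;
    do ?[apply: Sq1_in_part | apply: Sq2_in_part]; exact: v1.
- by move=> i j; rewrite !inE => /or4P[|||/orP[]] /eqP-> /or4P[|||/orP[]] /eqP->.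
- by [].
- move=> il v1; move: il; rewrite !inE => /or4P[|||/orP[]] /eqP-> //= v0;
    [exact: (Sq1_inj HQ0 low)|..]; apply: Sq2Sq1Sq2_inj_m1 => //.
  + by rewrite v0 !linear0.
  + by rewrite v0 linear0.
(* Both a and b kill a v, because aa = 0 and ba v = 0; so sending v to a v embeds copies of F in
   degree 0. *)
have [|||||i v|psi [psi_mono psiE]] :=
    @indexed_tens_mono_inj _ _ _ _ _ _ F_idx M (part M (-1)) (fun=> Sq1).
- by move=> i v _ _; rewrite unlock /= A1_rel.
- by move=> i v _ v1; rewrite unlock /= ba0.
- by move=> i v; rewrite [i \in _]inE => /eqP -> v1; apply: Sq1_in_part.
- by move=> i j; rewrite !inE => /eqP-> /eqP->.
- by [].
- by move=> _ v1; apply: (Sq1_inj HQ0 low).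
exists phi; split=> //.
  apply: (extends_inclusion_idx J_idx) phiE => i.
  by rewrite !inE => /or4P[|||/orP[]] /eqP->.
exists psi; split=> // v b c b0; rewrite psiE phiE.
(* Only label 1, whose operation is [Sq1], has degree 0. *)
by case: b b0 => [[|[|[|[|[|b]]]]] ?].
Qed.

End Injective.
End DegreeM1.
End Bottom.

(** * Assembly of the three cases, according to the lowest degree *)

Theorem theorem3p5 (M : A1module) (M_reduced : reduced M)
    (M_bounded_below : bounded_below M)
    (HQ0 : forall n : int, n < 0 -> Hzero (Q0 M) n)
    (HQ1 : forall n : int, n < 0 -> Hzero (Q1 M) n) :
  (forall n : int, n < - 3 -> is_zero (part M n)) /\
  (~ is_zero (part M (- 3)) ->
    [/\ exists phi : {linear tens (subspace (part M (- 3))) (shift 3 OmegaInv_F) -> M},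
          is_mono phi /\ extends_inclusion (- 3) phi,
        forall x, x \in part M (- 3) -> Q1 M (Sq1 (Sq2 x)) = 0
      & exists f : {linear subspace (part M (- 3)) -> subspace (cocycles (Q1 M) 0)},
          [/\ forall v, val (f v) = Sq1 (Sq2 (val v)),
              injective (fun v => Hclass (f v))
            & exists v, Hclass (f v) <> 0]]) /\
  (is_zero (part M (- 3)) -> ~ is_zero (part M (- 2)) ->
    let V : submodClosed M := cap (part M (- 2)) (ker (Sq1 \o Sq2)) in
    let W : submodClosed M := im (Sq1 \o Sq2) (part M (- 2)) in
    [/\ exists phi : {linear tens (subspace V) Joker -> M},
          is_mono phi /\ extends_inclusion (- 2) phi,
        forall x, x \in V -> Q1 M (Sq2 x) = 0,
        mono_to_H V Sq2 (Q1 M) 0,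
        mono_to_H W id (Q1 M) 1
      & Hzero (Q1 M) 1 -> V =i part M (- 2)]) /\
  (is_zero (part M (- 3)) -> is_zero (part M (- 2)) -> ~ is_zero (part M (- 1)) ->
    let X : submodClosed M := cap (part M (- 1)) (ker Sq2) in
    let Y : submodClosed M := cap (part M (- 1)) (ker (Sq2 \o Sq2)) in
    ({subset X <= Y} /\ {subset Y <= part M (- 1)}) /\
    [/\ (forall x, x \in Y -> Q1 M (Q0 M x) = 0) /\
        mono_to_H (im (Q0 M) Y) id (Q1 M) 0,
        [/\ forall x, x \in X -> Q1 M x = Sq2 (Sq1 x),
            {in X &, injective (Q1 M)}
          & exists phi : {linear tens (subspace X) (shift 3 OmegaInv_J) -> M},
              is_mono phi /\ extends_inclusion (- 1) phi]
      & is_zero X -> Hzero (Q1 M) 1 ->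
        {in part M (- 1) &, injective (fun x => Sq2 (Sq1 (Sq2 x)))} /\
        (Hzero (Q1 M) 2 ->
          Y =i part M (- 1) /\
          exists phi : {linear tens (subspace (part M (- 1))) (shift 6 OmegaInv2_J) -> M},
            [/\ is_mono phi,
                extends_inclusion (- 1) phi
              & exists psi : {linear tens (subspace (part M (- 1))) unit_module -> M},
                  is_mono psi /\
                  forall v (b : shift 6 OmegaInv2_J) (c : unit_module),
                    fdeg _ b = 0 -> psi (pure v c) = phi (pure v b)])]).
Proof.
have low3 := part_lt_m3 M_reduced M_bounded_below HQ0 HQ1.
split=> //; split; [move=> M3|split=> M3].
- have [f [fE f_inj]] := Sq1Sq2_mono_to_H M_reduced HQ0 HQ1 low3.
  split; [exact: part_m3_tens_mono|by move=> x _; apply: Q1_Sq1Sq2|exists f; split=> //].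
  (* Non-triviality follows from injectivity: if all classes were zero, every x in degree -3 would
     have the class of 0 and so vanish. *)
  apply: contrapT => f0; apply: M3 => x x3.
  have Hf0 v : Hclass (f v) = 0 by apply: contrapT => fv0; apply: f0; exists v.
  by have /(congr1 val) := f_inj (Subspace x3) 0 (etrans (Hf0 _) (esym (Hf0 _))).
- have low2 (k : int) : k < -2 -> is_zero (part M k).
    by have [-> _|k3 k2] := eqVneq k (-3); [|apply: low3; lia].
  move=> _ V W; split.
  + exact: V_tens_mono.
  + exact: Q1_Sq2_V.
  + exact: V_mono_to_H.
  + exact: W_mono_to_H.
  + exact: V_full.
move=> M2 _ X Y.
have low1 (k : int) : k < -1 -> is_zero (part M k).
  have [-> _ //|k2 k1] := eqVneq k (-2).
  by have [->//|k3] := eqVneq k (-3); apply: low3; lia.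
split; last split.
- split=> x /andP[x1 /eqP x0] //.
  by rewrite inE x1; apply/eqP; rewrite /= [Sq2 x]x0 linear0.
- by split; [exact: Q1_Q0_Y|exact: Q0_Y_mono_to_H].
- by split; [exact: Q1_X|exact: Q1_X_inj|exact: X_tens_mono].
move=> X0 H1; split; first exact: Sq2Sq1Sq2_inj.
by move=> H2; split; [exact: Y_full|exact: part_m1_tens_mono].
Qed.
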